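(* Let $n\ge1$. For every function $f(t)=\sum_{j=1}^n a_je^{\lambda_jt}$ with $a_j\in\mathbb{R}$ and real exponents $0\le\lambda_1<\lambda_2<\cdots<\lambda_n$, $$|f(0)| \le n\,\|f\|_{L_2[0,1]}.$$ This is sharp: the supremum of $|f(0)|/\|f\|_{L_2[0,1]}$ over all nonzero such $f$ equals $n$.
   Context: $\|f\|_{L_2[0,1]}=(\int_0^1|f(t)|^2dt)^{1/2}$. *)

(* Defs.v *)
From Stdlib Require Import Reals.
Open Scope R_scope.

Fixpoint fsum (n : nat) (g : nat -> R) : R :=
  match n with
  | O => 0
  | S m => fsum m g + g m
  end.

Definition expsum (n : nat) (a lam : nat -> R) (t : R) : R :=
  fsum n (fun j => a j * exp (lam j * t)).

Definition admissible_exps (n : nat) (lam : nat -> R) : Prop :=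
  0 <= lam O /\ (forall j : nat, (S j < n)%nat -> lam j < lam (S j)).

(* Main.v *)
(** Reflect [t] to [1 - t], so that [f] becomes a combination of the functions
    [exp (- lam_i u)], and let [D d] be the determinant of their Gram matrix on
    [0, d]. With [v] the vector of their values at 1, Jacobi's formula gives
    [D' 1 = v adj(G) v^T], and Cauchy-Schwarz for the Gram form bounds
    [f(0)^2 / ||f||^2] by [D' 1 / D 1]. So it is enough that [d^(n^2) D 1 <= D d]
    for [0 < d <= 1].

    This is checked on Riemann sums. By Cauchy-Binet the determinant of the
    discretized Gram matrix is [d^n] times a sum of squares of determinants
    [det (x_i ^ k_j)], where [x_i = exp (- lam_i d / N)], and
    such a determinant is, up to sign, the Vandermonde product of [x] times a
    Schur polynomial, which is nondecreasing in [x >= 0]. Passing from [d = 1] to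
    [d <= 1] increases every [x_i] and multiplies [|x_i - x_j|] by at least [d],
    which accounts for the remaining factor [d^(n(n-1))].

    For the monomials [u^i] scaling gives the equality [D d = d^(n^2) D 1], hence
    a polynomial [q] of degree [< n] with [q(1) = n ||q||]. Substituting
    [u = (e^h - e^(ht)) / (e^h - 1)] turns [q] into a sum with exponents
    [0, h, ..., (n-1)h] whose norm is at most [e^(h/2) ||q||]. *)

Require Import Defs.
From Stdlib Require Import Reals Lra.
From mathcomp Require Import all_boot all_order all_algebra all_fingroup.
From mathcomp Require Import Rstruct.
From Coquelicot Require Import Coquelicot.
Set Implicit Arguments.
Unset Strict Implicit.
Unset Printing Implicit Defensive.
Import Order.TTheory GRing.Theory Num.Theory.

(** * One-variable real analysis *)

Section RealAnalysis.
Local Open Scope R_scope.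

Lemma continuous_ex_RInt (f : R -> R) a b : (forall u, continuous f u) -> ex_RInt f a b.
Proof. by move=> fc; apply: ex_RInt_continuous => u _. Qed.

(** The integral over [[0, u]] lies between 0 and the whole integral, so it vanishes for every [u]
    in [(0, 1)]; its derivative at [t] is [f t * f t]. *)
Lemma RInt_sqr_eq0 (f : R -> R) : (forall u, continuous f u) ->
  RInt (fun u => f u * f u) 0 1 = 0 -> forall t, (0 < t < 1) -> f t = 0.
Proof.
move=> fc f0 t [t0 t1].
have cont u : continuous (fun v => f v * f v) u by apply: continuous_mult.
have ex a b := continuous_ex_RInt a b cont.
have int0 u : (0 < u < 1) -> RInt (fun u => f u * f u) 0 u = 0.
  move=> [u0 u1].
  have := @RInt_Chasles R_CompleteNormedModule (fun u => f u * f u) 0 u 1 (ex _ _) (ex _ _).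
  rewrite f0 /plus /=.
  have : (0 <= RInt (fun u => f u * f u) 0 u).
    by apply: RInt_ge_0; [lra|exact: ex|move=> v _; apply: Rle_0_sqr].
  have : (0 <= RInt (fun u => f u * f u) u 1).
    by apply: RInt_ge_0; [lra|exact: ex|move=> v _; apply: Rle_0_sqr].
  lra.
have D : is_derive (fun u => RInt (fun u => f u * f u) 0 u) t (f t * f t).
  apply: (@is_derive_RInt R_NormedModule (fun v => f v * f v) _ 0); last exact: cont.
  by apply: filter_forall => u; apply: RInt_correct.
have D0 : is_derive (fun u => RInt (fun u => f u * f u) 0 u) t 0.
  apply: (@is_derive_ext_loc R_AbsRing R_NormedModule (fun _ => 0)); last exact: is_derive_const.
  have [e he] : exists e : posreal, forall u, ball t e u -> (0 < u < 1).
    have e0 : (0 < Rmin t (1 - t)) by apply: Rmin_glb_lt; lra.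
    exists (mkposreal _ e0) => u; rewrite /ball /= /AbsRing_ball /abs /minus /plus /opp /=.
    move=> /Rabs_def2[]; have := Rmin_l t (1 - t); have := Rmin_r t (1 - t); lra.
  by exists e => u /he hu; rewrite int0.
have := is_derive_unique _ _ _ D; rewrite (is_derive_unique _ _ _ D0) => e.
by apply: Rsqr_0_uniq; rewrite /Rsqr -[LHS]e.
Qed.

(** By the mean value theorem, since [exp (- (d * t)) - d * exp (- t)] has derivative
    [d * (exp (- t) - exp (- (d * t))) <= 0] for [t >= 0]. This controls each factor of the
    Vandermonde product. *)
Lemma exp_diff_scale d a b : 0 <= d <= 1 -> 0 <= a -> 0 <= b ->
  d * Rabs (exp (- a) - exp (- b)) <= Rabs (exp (- (d * a)) - exp (- (d * b))).
Proof.
move=> [d0 d1].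
have main a' b' : 0 <= a' < b' ->
    d * Rabs (exp (- a') - exp (- b')) <= Rabs (exp (- (d * a')) - exp (- (d * b'))).
  move=> [a0 ab].
  have ea : exp (- b') <= exp (- a') by left; apply: exp_increasing; lra.
  have eda : exp (- (d * b')) <= exp (- (d * a')).
    have [->|db] := Req_dec d 0; first by rewrite !Rmult_0_l; lra.
    by left; apply: exp_increasing; nra.
  rewrite !Rabs_pos_eq; try lra.
  have [|c [E [ac cb]]] := MVT_cor2 (fun t => exp (- (d * t)) - d * exp (- t))
    (fun t => - d * exp (- (d * t)) + d * exp (- t)) a' b' ab.
    move=> c _; apply/is_derive_Reals; auto_derive => //; ring.
  have ec : exp (- c) <= exp (- (d * c)).
    have [->|d1'] := Req_dec d 1; first by rewrite Rmult_1_l; lra.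
    by left; apply: exp_increasing; nra.
  have := Rmult_le_pos _ _ (Rmult_le_pos _ _ d0 (proj1 (Rminus_le_0 _ _) ec))
    (Rlt_le _ _ (proj2 (Rlt_0_minus _ _) ab)); move: E; lra.
move=> a0 b0; have [ab|[->|ba]] := Rtotal_order a b.
- exact: main.
- by rewrite !Rminus_diag Rabs_R0; lra.
- by rewrite Rabs_minus_sym (Rabs_minus_sym (exp (- (d * a)))); apply: main.
Qed.

Lemma exp_opp_le x y : x <= y -> exp (- y) <= exp (- x).
Proof. by move=> [xy|->]; [left; apply: exp_increasing; lra|right]. Qed.

Lemma RInt_exp_opp c d : 0 < c -> RInt (fun u => exp (- (c * u))) 0 d = (1 - exp (- (c * d))) / c.
Proof.
move=> c0; apply: is_RInt_unique.
have -> : (1 - exp (- (c * d))) / c = minus (- exp (- (c * d)) / c) (- exp (- (c * 0)) / c).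
  rewrite /minus /plus /opp /= Rmult_0_r Ropp_0 exp_0; field; lra.
apply: (@is_RInt_derive R_CompleteNormedModule (fun u => - exp (- (c * u)) / c)) => u _.
  auto_derive => //; field; lra.
apply: (@ex_derive_continuous R_AbsRing R_NormedModule); auto_derive => //.
Qed.

(** The sequence is the summed geometric series of the Riemann sums of [exp (- (c * u))] on
    [[0, d]]. With [y = c * d / INR N.+1] it equals [I * (y / (1 - exp (- y)))], squeezed between
    [I] and [I * exp y]. *)
Lemma is_lim_seq_exp_ratio c d : 0 < c -> 0 < d ->
  is_lim_seq (fun N => d / INR N.+1 * ((1 - exp (- (c * d))) / (1 - exp (- (c * d / INR N.+1)))))
    ((1 - exp (- (c * d))) / c).
Proof.
move=> c0 d0; set I := (1 - _) / c.
have cd0 : 0 < c * d by nra.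
have I0 : 0 <= I.
  apply: Rmult_le_pos; last by left; apply: Rinv_0_lt_compat.
  have : exp (- (c * d)) < exp 0 by apply: exp_increasing; lra.
  rewrite exp_0; lra.
have hlim : is_lim_seq (fun N => c * d / INR N.+1) 0.
  have -> : Finite 0 = Rbar_mult (c * d) (Rbar_inv p_infty) by rewrite /= Rmult_0_r.
  apply: is_lim_seq_scal_l; apply: is_lim_seq_inv => //.
  exact: (is_lim_seq_incr_1 INR _).1 is_lim_seq_INR.
apply: (is_lim_seq_le_le (fun=> I) _ (fun N => I * exp (c * d / INR N.+1))).
- move=> N; have N0 : 0 < INR N.+1 by exact: lt_0_INR (PeanoNat.Nat.lt_0_succ N).
  set y := c * d / INR N.+1.
  have y0 : 0 < y by apply: Rdiv_lt_0_compat.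
  have -> : d / INR N.+1 = y / c by rewrite /y; field; lra.
  have e1 : exp (- y) < 1 by rewrite -exp_0; apply: exp_increasing; lra.
  have lo : 1 - exp (- y) <= y by have := exp_ineq1_le (- y); lra.
  have hi : y * exp (- y) <= 1 - exp (- y).
    have := exp_ineq1_le y; have := exp_pos (- y).
    have : exp y * exp (- y) = 1 by rewrite -exp_plus Rplus_opp_r exp_0.
    nra.
  have -> : y / c * ((1 - exp (- (c * d))) / (1 - exp (- y))) = I * (y / (1 - exp (- y))).
    rewrite /I; field; lra.
  split.
    rewrite -[X in X <= _]Rmult_1_r; apply: Rmult_le_compat_l => //.
    by apply: (Rmult_le_reg_r (1 - exp (- y))); [lra|field_simplify; lra].
  apply: Rmult_le_compat_l => //; apply: (Rmult_le_reg_r (1 - exp (- y))); first lra.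
  have -> : y / (1 - exp (- y)) * (1 - exp (- y)) = y by field; lra.
  have := exp_pos y; have : exp y * exp (- y) = 1 by rewrite -exp_plus Rplus_opp_r exp_0.
  nra.
- exact: is_lim_seq_const.
- have {2}-> : I = I * exp 0 by rewrite exp_0 Rmult_1_r.
  apply: (is_lim_seq_scal_l _ I (exp 0)).
  apply: (is_lim_seq_continuous exp) => //.
  by apply: derivable_continuous_pt; apply: derivable_pt_exp.
Qed.

(** The difference [f - g] is nonnegative to the left of 1 and zero at 1, so its left difference
    quotients there are nonpositive. *)
Lemma le_derive_of_touch (f g : R -> R) (df dg : R) :
  is_derive f 1 df -> is_derive g 1 dg -> f 1 = g 1 ->
  (forall d, 0 < d <= 1 -> g d <= f d) -> df <= dg.
Proof.
move=> Df Dg fg1 gf; apply: Rnot_lt_le => dfg.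
have /is_derive_Reals D : is_derive (fun u => f u - g u) 1 (df - dg) by apply: is_derive_minus.
have e0 : 0 < df - dg by lra.
have [e he] := D _ e0.
have e2 := cond_pos e; set h := - Rmin (e / 2) (1 / 2).
have m0 : 0 < Rmin (e / 2) (1 / 2) by apply: Rmin_glb_lt; lra.
have m1 := Rmin_l (e / 2) (1 / 2); have m2 := Rmin_r (e / 2) (1 / 2).
have h0 : h < 0 by rewrite /h; lra.
have hh : Rabs h < e by rewrite Rabs_left /h; lra.
have := he h (Rlt_not_eq _ _ h0) hh.
have /gf : 0 < 1 + h <= 1 by rewrite /h; lra.
rewrite fg1 => hf /Rabs_def2[_].
have : (f (1 + h) - g (1 + h) - (g 1 - g 1)) / h <= 0.
  rewrite Rminus_diag Rminus_0_r; have := Rinv_lt_0_compat _ h0.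
  rewrite /Rdiv; nra.
lra.
Qed.

Lemma RInt_pow m d : RInt (fun u => u ^ m) 0 d = d ^ m.+1 / INR m.+1.
Proof.
have N0 := not_0_INR m.+1 (PeanoNat.Nat.neq_succ_0 m).
apply: is_RInt_unique.
have -> : d ^ m.+1 / INR m.+1 = minus (d ^ m.+1 / INR m.+1) (0 ^ m.+1 / INR m.+1).
  rewrite (pow_i _ (PeanoNat.Nat.lt_0_succ m)) Rdiv_0_l.
  by symmetry; apply: Rminus_0_r.
apply: (@is_RInt_derive R_CompleteNormedModule (fun u => u ^ m.+1 / INR m.+1)) => u _.
  by auto_derive => //; field.
by apply: (@ex_derive_continuous R_AbsRing R_NormedModule); auto_derive.
Qed.

Lemma RInt_flip (f : R -> R) : (forall u, continuous f u) ->
  RInt (fun u => f (1 - u)) 0 1 = RInt f 0 1.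
Proof.
move=> fc.
have := @RInt_comp_lin R_CompleteNormedModule f (-1) 1 0 1 (continuous_ex_RInt _ _ fc).
rewrite (_ : -1 * 0 + 1 = 1); last ring.
rewrite (_ : -1 * 1 + 1 = 0); last ring.
rewrite -(opp_RInt_swap f); last exact: continuous_ex_RInt.
rewrite (RInt_ext _ (fun u => opp (f (1 - u)))); last first.
  move=> u _; rewrite (_ : -1 * u + 1 = 1 - u); last ring.
  by rewrite /scal /opp /= /mult /=; ring.
rewrite RInt_opp; last first.
  apply: continuous_ex_RInt => u; apply: continuous_comp; last exact: fc.
  by apply: (@ex_derive_continuous R_AbsRing R_NormedModule); auto_derive.
rewrite /opp /=; lra.
Qed.

(** Substituting [z] gives [exp (h * t) dt = - (c / h) dz], where [exp (h * t) >= 1] on [[0, 1]] and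
    [c / h <= exp h]. The substitution reverses the interval, so [t = 0] corresponds to the point
    1. *)
Lemma RInt_exp_subst_le (P : R -> R) h : 0 < h ->
  (forall u, continuous P u) -> (forall u, 0 <= P u) ->
  RInt (fun t => P ((exp h - exp (h * t)) / (exp h - 1))) 0 1 <= exp h * RInt P 0 1.
Proof.
move=> h0 Pc P0; set c := exp h - 1; set z := fun t => (exp h - exp (h * t)) / c.
have eh := exp_ineq1 h (Rgt_not_eq _ _ h0).
have c0 : 0 < c by rewrite /c; lra.
have ch : c / h <= exp h.
  apply: (Rmult_le_reg_r h) => //; rewrite /Rdiv Rmult_assoc Rinv_l; last lra.
  have := exp_ineq1_le (- h); have := exp_pos h.
  have : exp h * exp (- h) = 1 by rewrite -exp_plus Rplus_opp_r exp_0.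
  rewrite /c; nra.
have zc u : continuous z u.
  by apply: (@ex_derive_continuous R_AbsRing R_NormedModule); rewrite /z; auto_derive; lra.
have Pzc u : continuous (fun t => P (z t)) u by apply: continuous_comp.
pose dz t := - (h * exp (h * t) / c).
have dzc u : continuous dz u.
  by apply: (@ex_derive_continuous R_AbsRing R_NormedModule); rewrite /dz; auto_derive; lra.
have subst : is_RInt (fun t => scal (dz t) (P (z t))) 0 1 (RInt P (z 0) (z 1)).
  apply: is_RInt_comp => u _ //; split => //.
  by rewrite /z /dz; auto_derive; [lra|field; lra].
have z0 : z 0 = 1 by rewrite /z Rmult_0_r exp_0; apply: Rdiv_diag (Rgt_not_eq _ _ c0).
have z1 : z 1 = 0 by rewrite /z Rmult_1_r Rminus_diag; apply: Rdiv_0_l.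
rewrite z0 z1 -(opp_RInt_swap P) in subst; last exact: continuous_ex_RInt.
have {}subst := is_RInt_unique _ _ _ _ (is_RInt_scal _ _ _ (- (c / h)) _ subst).
have I0 : 0 <= RInt P 0 1 by apply: RInt_ge_0; [lra|exact: continuous_ex_RInt|].
apply: (Rle_trans _ (c / h * RInt P 0 1)); last by apply: Rmult_le_compat_r.
rewrite (_ : c / h * RInt P 0 1 = scal (- (c / h)) (opp (RInt P 0 1))); last first.
  by rewrite /scal /opp /= /mult /=; ring.
rewrite -subst; apply: RInt_le; first lra.
- exact: continuous_ex_RInt.
- apply: continuous_ex_RInt => u; apply: continuous_mult; first exact: continuous_const.
  by apply: continuous_mult.
move=> t [t0 _]; rewrite /scal /= /mult /= /dz.
have -> : - (c / h) * (- (h * exp (h * t) / c) * P (z t)) = exp (h * t) * P (z t).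
  by field; lra.
have e1 : 1 <= exp (h * t).
  by have := exp_ineq1_le (h * t); have := Rmult_lt_0_compat _ _ h0 t0; lra.
by have := Rmult_le_compat_r _ _ _ (P0 (z t)) e1; rewrite Rmult_1_l.
Qed.

Lemma le_of_sqr_le n s I : 0 <= n -> 0 <= I -> s * s <= n * n * I -> Rabs s <= n * sqrt I.
Proof.
move=> n0 I0 sI; rewrite -sqrt_Rsqr_abs -[X in X * _]sqrt_square // -sqrt_mult //; last nra.
exact: sqrt_le_1_alt.
Qed.

Lemma lt_of_almost_sqr n eps s I : 0 < n -> 0 < eps -> s <> 0 -> 0 <= I ->
  n * n * I <= exp (eps / n) * (s * s) -> (n - eps) * sqrt I < Rabs s.
Proof.
move=> n0 e0 s0 I0 H.
have s1 : 0 < Rabs s by apply: Rabs_pos_lt.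
set r := sqrt I; have r0 : 0 <= r by apply: sqrt_pos.
have rI : r * r = I by apply: sqrt_sqrt.
(* Half of [eps] pays for the square root of [exp (eps / n)], through [exp (- x) >= 1 - x]; the
   other half makes the inequality strict when [r > 0]. *)
set x := eps / (2 * n).
have nx : n * x = eps / 2 by rewrite /x; field; lra.
have EE : exp (eps / n) = exp x * exp x by rewrite -exp_plus; congr exp; rewrite /x; field; lra.
have E1 : exp x * exp (- x) = 1 by rewrite -exp_plus Rplus_opp_r exp_0.
have Ex := exp_pos x; have Ex' := exp_pos (- x); have Ex1 := exp_ineq1_le (- x).
have ss : s * s = Rabs s * Rabs s by rewrite -/(Rsqr s) Rsqr_abs.
have nr : n * r <= exp x * Rabs s.
  apply: Rsqr_incr_0; rewrite /Rsqr; [|nra|nra].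
  by rewrite EE ss -rI in H; lra.
have nr' : n * r * exp (- x) <= Rabs s.
  have := Rmult_le_compat_r _ _ _ (Rlt_le _ _ Ex') nr.
  have -> : exp x * Rabs s * exp (- x) = exp x * exp (- x) * Rabs s by ring.
  by rewrite E1 Rmult_1_l.
have h : (n - eps / 2) * r <= Rabs s.
  have := Rmult_le_compat_l _ _ _ (Rmult_le_pos _ _ (Rlt_le _ _ n0) r0) Ex1.
  nra.
case: r0 => [r0|r0]; last by rewrite -r0 Rmult_0_r.
nra.
Qed.

End RealAnalysis.

(* The [ring] and [field] imported here shadow those of Stdlib and do not see
   the operations of [R_scope]. *)
From mathcomp Require Import ring zify.

Local Open Scope ring_scope.

(** * Cauchy-Binet and generalized Vandermonde determinants *)

(** Cauchy-Binet over all maps instead of subsets: each column of the product combines columns of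
    [A], and multilinearity selects column [f j] at position [j]. Non-injective maps contribute
    zero. *)
Lemma det_mulmx_ffun (R : comNzRingType) (n m : nat)
    (A : 'M[R]_(n, m)) (B : 'M[R]_(m, n)) :
  \det (A *m B) = \sum_(f : {ffun 'I_n -> 'I_m})
    (\prod_j B (f j) j) * \det (\matrix_(i, j) A i (f j)).
Proof.
rewrite -det_tr trmx_mul.
transitivity (\sum_(s : 'S_n) \sum_(f : {ffun 'I_n -> 'I_m})
    (-1) ^+ s * \prod_j (B (f j) j * A (s j) (f j))).
  apply: eq_bigr => s _; rewrite -big_distrr /=; congr (_ * _).
  rewrite -(bigA_distr_bigA (fun j k => B k j * A (s j) k)) /=.
  by apply: eq_bigr => j _; rewrite mxE; apply: eq_bigr => k _; rewrite !mxE.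
rewrite exchange_big; apply: eq_bigr => f _ /=.
rewrite -[in RHS]det_tr big_distrr /=; apply: eq_bigr => s _.
rewrite big_split /= mulrCA; congr (_ * (_ * _)).
by apply: eq_bigr => j _; rewrite !mxE.
Qed.

(** Precomposing [f] with a permutation costs its sign. Summing over all [n!] permutations assembles
    the products of entries into a second determinant, hence the square. *)
Lemma det_gram_ffun (R : comNzRingType) (n m : nat) (A : 'M[R]_(n, m)) :
  \det (A *m A^T) *+ n`! =
  \sum_(f : {ffun 'I_n -> 'I_m}) \det (\matrix_(i, j) A i (f j)) ^+ 2.
Proof.
have perm_f (s : 'S_n) : \det (A *m A^T) = \sum_(f : {ffun 'I_n -> 'I_m})
    ((-1) ^+ s * \prod_j A j (f (s j))) * \det (\matrix_(i, j) A i (f j)).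
  rewrite det_mulmx_ffun.
  rewrite (reindex_inj (h := fun f : {ffun 'I_n -> 'I_m} =>
     [ffun j => f (s j)])) /=; last first.
    move=> f g /ffunP fg; apply/ffunP => j.
    by have := fg (s^-1 j)%g; rewrite !ffunE permKV.
  apply: eq_bigr => f _.
  have -> : \matrix_(i, j) A i ([ffun j => f (s j)] j) =
            col_perm s (\matrix_(i, j) A i (f j)).
    by apply/matrixP => i j; rewrite !mxE ffunE.
  rewrite col_permE det_mulmx det_perm odd_permV.
  rewrite [\det _ * _]mulrC mulrA [in RHS](mulrC ((-1) ^+ s)).
  by congr (_ * _ * _); apply: eq_bigr => j _; rewrite mxE ffunE.
have -> : \det (A *m A^T) *+ n`! = \sum_(s : 'S_n) \det (A *m A^T).
  by rewrite sumr_const card_Sn.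
rewrite (eq_bigr _ (fun s _ => perm_f s)) exchange_big.
apply: eq_bigr => f _ /=; rewrite -big_distrl /= expr2; congr (_ * _).
by apply: eq_bigr => s _; congr (_ * _); apply: eq_bigr => j _; rewrite mxE.
Qed.

(** A telescoping geometric sum over the window [p <= a < q], padded with zeros so that it is an
    entry of a matrix product. *)
Lemma sum_window_subr (R : comNzRingType) (m p q : nat) (x y : R) :
  (p <= q)%N -> (q <= m)%N ->
  (\sum_(a < m) x ^+ a * (if (p <= a < q)%N then y ^+ (q.-1 - a) else 0)) *
    (x - y) = x ^+ q - x ^+ p * y ^+ (q - p).
Proof.
move=> pq qm.
have -> : \sum_(a < m) x ^+ a * (if (p <= a < q)%N then y ^+ (q.-1 - a) else 0)
        = \sum_(p <= a < q) x ^+ a * y ^+ (q.-1 - a).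
  rewrite -(big_mkord xpredT
    (fun a => x ^+ a * (if (p <= a < q)%N then y ^+ (q.-1 - a) else 0))).
  rewrite (big_cat_nat (leq0n p) (leq_trans pq qm)) /=.
  rewrite (big_cat_nat pq qm) /=.
  rewrite [X in X + _](_ : _ = 0) ?add0r; last first.
    rewrite big_nat_cond big1 // => a /andP[/andP[_ ap] _].
    by rewrite leqNgt ap mulr0.
  rewrite [X in _ + X](_ : _ = 0) ?addr0; last first.
    rewrite big_nat_cond big1 // => a /andP[/andP[qa _] _].
    by rewrite [(a < q)%N]ltnNge qa andbF mulr0.
  rewrite big_nat_cond [in RHS]big_nat_cond.
  by apply: eq_bigr => a /andP[-> _].
rewrite big_distrl /=.
rewrite (telescope_sumr_eq (fun a => x ^+ a * y ^+ (q - a))) //; last first.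
  move=> a /andP[_ aq]; rewrite -subn1 -subnDA add1n -(subnSK aq) exprSr exprSr.
  by rewrite mulrBr -!mulrA (mulrC x) !mulrA.
by rewrite subnn expr0 mulr1.
Qed.

(** The product of [x j - x i] over [i < j], peeled from index 0 to match the induction on
    determinants of powers. *)
Fixpoint vander (R : comNzRingType) n : ('I_n -> R) -> R :=
  if n is n'.+1 then fun x =>
    \prod_(i < n') (x (lift ord0 i) - x ord0) *
    vander (fun i : 'I_n' => x (lift ord0 i))
  else fun=> 1.

(* Subtracting [x_0 ^ (k_(j+1) - k_j)] times column [j] from column [j+1] clears
   row 0; dividing each remaining row by [x_i - x_0] leaves columns which are
   sums of powers with exponents in the windows [k_j, k_(j+1)). *)
Lemma det_power_step (R : comNzRingType) n (k : 'I_n.+1 -> nat)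
    (x : 'I_n.+1 -> R) :
  (forall i j : 'I_n.+1, (i <= j)%N -> (k i <= k j)%N) ->
  \det (\matrix_(i, j) x i ^+ k j) =
  x ord0 ^+ k ord0 * \prod_(i < n) (x (lift ord0 i) - x ord0) *
  \sum_(f : {ffun 'I_n -> 'I_(k ord_max)})
    \prod_j (if (k (widen_ord (leqnSn n) j) <= f j < k (lift ord0 j))%N
             then x ord0 ^+ ((k (lift ord0 j)).-1 - f j) else 0) *
    \det (\matrix_(i, j) x (lift ord0 i) ^+ f j).
Proof.
move=> kmono.
pose U := \matrix_(i < n.+1, j < n.+1)
  ((i == j)%:R - (i.+1 == j :> nat)%:R * x ord0 ^+ (k j - k i)) : 'M[R]_n.+1.
have detU : \det U = 1.
  rewrite -det_tr det_trig; last first.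
    apply/is_trig_mxP => i j ij; rewrite !mxE.
    by rewrite -val_eqE /= (gtn_eqF ij) (gtn_eqF (leqW ij)) mul0r subr0.
  rewrite big1 // => i _; rewrite !mxE eqxx.
  by rewrite gtn_eqF // mul0r subr0.
rewrite -[LHS]mulr1 -[X in _ * X = _]detU -det_mulmx; set M := _ *m U.
have M0 i : M i ord0 = x i ^+ k ord0.
  rewrite mxE (bigD1 ord0) //= !mxE eqxx /= mul0r subr0 mulr1.
  rewrite big1 ?addr0 // => j; rewrite !mxE -val_eqE /= => /negPf ->.
  by rewrite mul0r subr0 mulr0.
have MS i j : M i (lift ord0 j) = x i ^+ k (lift ord0 j) -
    x i ^+ k (widen_ord (leqnSn n) j) *
    x ord0 ^+ (k (lift ord0 j) - k (widen_ord (leqnSn n) j)).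
  rewrite mxE (bigD1 (lift ord0 j)) //= !mxE eqxx.
  rewrite gtn_eqF // mul0r subr0 mulr1; congr (_ + _).
  have wl : widen_ord (leqnSn n) j != lift ord0 j.
    by rewrite -val_eqE /= ltn_eqF.
  rewrite (bigD1 (widen_ord (leqnSn n) j)) //= !mxE (negPf wl).
  rewrite eqxx mul1r sub0r mulrN big1 ?addr0 // => l /andP[/negPf l1 l2].
  rewrite !mxE l1 /= /bump /= add1n eqSS.
  have -> : (l == j :> nat) = false by apply: contraNF l2 => /eqP e; apply/eqP/val_inj.
  by rewrite mul0r subr0 mulr0.
rewrite (expand_det_row _ ord0) big_ord_recl big1 ?addr0; last first.
  move=> j _; rewrite MS -exprD subnKC ?subrr ?mul0r //.
  by apply: kmono; rewrite /= /bump /=.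
rewrite M0 -mulrA; congr (_ * _); rewrite /cofactor expr0 mul1r.
(* The remaining minor is [diag_mx d] times powers times window coefficients, so Cauchy-Binet
   expands it into smaller determinants of powers. *)
pose A : 'M[R]_(n, k ord_max) := \matrix_(i, a) x (lift ord0 i) ^+ a.
pose B : 'M[R]_(k ord_max, n) := \matrix_(a, j)
  (if (k (widen_ord (leqnSn n) j) <= a < k (lift ord0 j))%N
   then x ord0 ^+ ((k (lift ord0 j)).-1 - a) else 0).
pose d : 'rV[R]_n := \row_i (x (lift ord0 i) - x ord0).
have -> : row' ord0 (col' ord0 M) = diag_mx d *m (A *m B).
  apply/matrixP => i j; rewrite mul_diag_mx [LHS]mxE [LHS]mxE [LHS]MS !mxE.
  rewrite -(@sum_window_subr _ (k ord_max)); last 2 first.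
  - by apply: kmono => /=.
  - by apply: kmono; rewrite -ltnS ltn_ord.
  by rewrite mulrC; congr (_ * _); apply: eq_bigr => a _; rewrite !mxE.
rewrite det_mulmx det_diag det_mulmx_ffun; congr (_ * _).
  by apply: eq_bigr => i _; rewrite mxE.
apply: eq_bigr => f _; congr (_ * _).
  by apply: eq_bigr => j _; rewrite mxE.
by congr (\det _); apply/matrixP => i j; rewrite !mxE.
Qed.

Definition nonneg_mono (R : numDomainType) n (S : ('I_n -> R) -> R) :=
  forall x y, (forall i, 0 <= x i <= y i) -> 0 <= S x <= S y.

(* [S] is a Schur polynomial: the exponents [f] contributing to
   [det_power_step] interlace [k], hence are again sorted, and their
   coefficients are products of powers of [x_0]. *)
Lemma det_power_sorted (R : realDomainType) n (k : 'I_n -> nat) :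
  (forall i j : 'I_n, (i <= j)%N -> (k i <= k j)%N) ->
  exists2 S : ('I_n -> R) -> R, nonneg_mono S &
    forall x, \det (\matrix_(i, j) x i ^+ k j) = vander x * S x.
Proof.
elim: n k => [|n IHn] k kmono.
  exists (fun=> 1) => [x y _|x]; first by rewrite ler01 lexx.
  by rewrite det_mx00 /= mulr1.
pose F := {ffun 'I_n -> 'I_(k ord_max)}.
pose ok (f : F) := [forall j,
  (k (widen_ord (leqnSn n) j) <= f j < k (lift ord0 j))%N].
(* A non-interlacing [f] has a zero coefficient, so any [S] serves. An interlacing one is sorted:
   for [i < j], [f i] is below [k] at [i + 1], which is at most [k] at [j], hence at most [f j]. *)
have ex_S (f : F) : exists S : ('I_n -> R) -> R, nonneg_mono S /\
    (ok f -> forall x, \det (\matrix_(i, j) x i ^+ f j) = vander x * S x).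
  case: (boolP (ok f)) => [/forallP okf|_]; last first.
    by exists (fun=> 1); split=> // x y _; rewrite ler01 lexx.
  have [|S S1 S2] := IHn (fun j => f j); last by exists S.
  move=> i j; rewrite leq_eqVlt => /predU1P[/val_inj -> //|ij].
  have /andP[_ /ltnW fi] := okf i; have /andP[fj _] := okf j.
  by apply: leq_trans fi (leq_trans _ fj); apply: kmono.
have [S HS] := fin_all_exists ex_S.
pose c (f : F) (z : R) (j : 'I_n) :=
  if (k (widen_ord (leqnSn n) j) <= f j < k (lift ord0 j))%N
  then z ^+ ((k (lift ord0 j)).-1 - f j) else 0.
exists (fun x => x ord0 ^+ k ord0 *
  \sum_(f : F) (\prod_j c f (x ord0) j) * S f (fun i => x (lift ord0 i))).
  move=> x y xy; have /andP[x0 xy0] := xy ord0.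
  have cxy f j : 0 <= c f (x ord0) j <= c f (y ord0) j.
    rewrite /c; case: ifP => _; last by rewrite lexx.
    by rewrite exprn_ge0 //= lerXn2r // nnegrE // (le_trans x0).
  have pxy (f : F) : 0 <= \prod_j c f (x ord0) j <= \prod_j c f (y ord0) j.
    by rewrite ler_prod // prodr_ge0 // => j _; case/andP: (cxy f j).
  have Sxy f : 0 <= S f (fun i => x (lift ord0 i)) <= S f (fun i => y (lift ord0 i)).
    by apply: (HS f).1.
  have sx : 0 <= \sum_(f : F) (\prod_j c f (x ord0) j) * S f (fun i => x (lift ord0 i)).
    by apply: sumr_ge0 => f _; have /andP[? _] := pxy f; have /andP[? _] := Sxy f; apply: mulr_ge0.
  rewrite mulr_ge0 ?exprn_ge0 //=; apply: ler_pM => //; first exact: exprn_ge0.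
    by rewrite lerXn2r // nnegrE // (le_trans x0).
  apply: ler_sum => f _; have /andP[? ?] := pxy f; have /andP[? ?] := Sxy f.
  exact: ler_pM.
move=> x; rewrite det_power_step //= -!mulrA mulrCA; congr (_ * _).
rewrite mulrCA; congr (_ * _); rewrite big_distrr; apply: eq_bigr => f _ /=.
case: (boolP (ok f)) => [okf|/forallPn[j /negPf nj]].
  by rewrite (HS f).2 // mulrCA.
have z : \prod_j c f (x ord0) j = 0 by rewrite (bigD1 j) //= /c nj mul0r.
by rewrite /c in z *; rewrite z !mul0r mulr0.
Qed.

Lemma sorting_perm n (k : 'I_n -> nat) : exists s : 'S_n,
  forall i j : 'I_n, (i <= j)%N -> (k (s i) <= k (s j))%N.
Proof.
pose t := [tuple k i | i < n].
have /tuple_permP[s ts] : perm_eq (sort leq t) t by rewrite perm_sort.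
exists s => i j ij.
have E (l : 'I_n) : k (s l) = nth 0%N (sort leq t) l.
  by rewrite ts -tnth_nth !tnth_mktuple.
rewrite !E; apply: (sorted_leq_nth leq_trans leqnn) => //.
- by apply: sort_sorted; apply: leq_total.
- by rewrite inE size_sort size_tuple.
- by rewrite inE size_sort size_tuple.
Qed.

(** Cauchy-Binet over arbitrary maps produces unsorted exponents; sorting them changes only the sign
    of the determinant, which squaring removes. *)
Lemma det_power (R : realDomainType) n (k : 'I_n -> nat) :
  exists2 S : ('I_n -> R) -> R, nonneg_mono S &
    forall x, \det (\matrix_(i, j) x i ^+ k j) ^+ 2 = (vander x * S x) ^+ 2.
Proof.
have [s ks] := sorting_perm k; have [S S1 S2] := det_power_sorted R ks.
exists S => // x; rewrite -S2.
have -> : \matrix_(i, j) x i ^+ k (s j) = col_perm s (\matrix_(i, j) x i ^+ k j).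
  by apply/matrixP => i j; rewrite !mxE.
by rewrite col_permE det_mulmx det_perm exprMn sqrr_sign mulr1.
Qed.

(** Each pair of indices costs one factor [d]; Pascal's rule counts the pairs. *)
Lemma vander_scale (R : realDomainType) n (d : R) (x y : 'I_n -> R) : 0 <= d ->
  (forall i j, d * `|y i - y j| <= `|x i - x j|) ->
  d ^+ 'C(n, 2) * `|vander y| <= `|vander x|.
Proof.
elim: n x y => [|n IHn] x y d0 dxy; first by rewrite mul1r.
rewrite /= binS bin1 addnC exprD !normrM mulrACA.
apply: ler_pM; rewrite ?mulr_ge0 ?exprn_ge0 //; last exact: IHn.
rewrite !normr_prod -[X in d ^+ X]card_ord -prodr_const -big_split /=.
by apply: ler_prod => i _; rewrite mulr_ge0 //=; apply: dxy.
Qed.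

Lemma power_gramE (R : comNzRingType) n m (x : 'I_n -> R) :
  \matrix_(i, j) \sum_(k < m) x i ^+ k * x j ^+ k =
  (\matrix_(i < n, k < m) x i ^+ k) *m (\matrix_(i < n, k < m) x i ^+ k)^T.
Proof.
by apply/matrixP => i j; rewrite !mxE; apply: eq_bigr => k _; rewrite !mxE.
Qed.

Lemma det_gram_ge0 (R : realDomainType) n m (A : 'M[R]_(n, m)) :
  0 <= \det (A *m A^T).
Proof.
rewrite -(pmulrn_lge0 _ (fact_gt0 n)) det_gram_ffun.
by apply: sumr_ge0 => f _; apply: sqr_ge0.
Qed.

(** The comparison holds term by term in the sum of squares: the Schur factor is monotone, the
    Vandermonde product supplies [d ^+ 'C(n, 2)], and squaring doubles the exponent. *)
Lemma det_gram_scale (R : realDomainType) n m (d : R) (x y : 'I_n -> R) :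
  0 <= d -> (forall i, 0 <= y i <= x i) ->
  (forall i j, d * `|y i - y j| <= `|x i - x j|) ->
  d ^+ ('C(n, 2).*2) * \det (\matrix_(i, j) \sum_(k < m) y i ^+ k * y j ^+ k)
  <= \det (\matrix_(i, j) \sum_(k < m) x i ^+ k * x j ^+ k).
Proof.
move=> d0 yx dxy.
rewrite !power_gramE -(ler_pMn2r (fact_gt0 n)) -mulrnAr !det_gram_ffun big_distrr /=.
apply: ler_sum => f _.
have F (z : 'I_n -> R) : \matrix_(i, j) (\matrix_(i < n, k < m) z i ^+ k) i (f j)
    = \matrix_(i, j) z i ^+ f j by apply/matrixP => i j; rewrite !mxE.
have [S S1 S2] := det_power R (fun j => f j).
rewrite !F !S2 -muln2 exprM -exprMn -[leLHS]real_normK ?num_real //.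
rewrite -[leRHS]real_normK ?num_real // lerXn2r ?nnegrE // mulrA !normrM.
have /andP[Sy Syx] := S1 _ _ yx; rewrite (ger0_norm Sy).
rewrite (ger0_norm (le_trans Sy Syx)) (ger0_norm (exprn_ge0 _ d0)).
by apply: ler_pM => //; [rewrite mulr_ge0 ?exprn_ge0 | exact: vander_scale].
Qed.

(** * Limits and derivatives of determinants *)

Lemma is_lim_seq_sum (I : Type) (r : seq I) (F : nat -> I -> R) (l : I -> R) :
  (forall i, is_lim_seq (fun N => F N i) (l i)) ->
  is_lim_seq (fun N => \sum_(i <- r) F N i) (\sum_(i <- r) l i).
Proof.
move=> Fl; elim: r => [|i r IHr].
  rewrite big_nil; apply: (is_lim_seq_ext (fun=> 0)) (is_lim_seq_const _).
  by move=> N; rewrite big_nil.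
rewrite big_cons; apply: (is_lim_seq_ext (fun N => F N i + \sum_(j <- r) F N j)).
  by move=> N; rewrite big_cons.
exact: is_lim_seq_plus'.
Qed.

Lemma is_lim_seq_prod (I : Type) (r : seq I) (F : nat -> I -> R) (l : I -> R) :
  (forall i, is_lim_seq (fun N => F N i) (l i)) ->
  is_lim_seq (fun N => \prod_(i <- r) F N i) (\prod_(i <- r) l i).
Proof.
move=> Fl; elim: r => [|i r IHr].
  rewrite big_nil; apply: (is_lim_seq_ext (fun=> 1)) (is_lim_seq_const _).
  by move=> N; rewrite big_nil.
rewrite big_cons; apply: (is_lim_seq_ext (fun N => F N i * \prod_(j <- r) F N j)).
  by move=> N; rewrite big_cons.
exact: is_lim_seq_mult'.
Qed.

Lemma is_lim_seq_det n (M : nat -> 'M[R]_n) (L : 'M[R]_n) :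
  (forall i j, is_lim_seq (fun N => M N i j) (L i j)) ->
  is_lim_seq (fun N => \det (M N)) (\det L).
Proof.
move=> ML; apply: is_lim_seq_sum => s.
apply: is_lim_seq_mult'; first exact: is_lim_seq_const.
by apply: is_lim_seq_prod.
Qed.

Lemma is_derive_bigsum (I : Type) (r : seq I) (F : I -> R -> R) (dF : I -> R) t :
  (forall i, is_derive (F i) t (dF i)) ->
  is_derive (fun t => \sum_(i <- r) F i t) t (\sum_(i <- r) dF i).
Proof.
move=> dFP; elim: r => [|i r IHr].
  rewrite big_nil; apply: (@is_derive_ext R_AbsRing R_NormedModule (fun=> 0)); last exact: is_derive_const.
  by move=> u; rewrite big_nil.
rewrite big_cons; apply: (@is_derive_ext R_AbsRing R_NormedModule (fun u => F i u + \sum_(j <- r) F j u)).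
  by move=> u; rewrite big_cons.
exact: is_derive_plus.
Qed.

Lemma is_derive_bigprod (I : eqType) (r : seq I) (F : I -> R -> R) (dF : I -> R) t :
  uniq r -> (forall i, is_derive (F i) t (dF i)) ->
  is_derive (fun t => \prod_(i <- r) F i t) t
    (\sum_(i <- r) \prod_(j <- r) (if j == i then dF j else F j t)).
Proof.
move=> + dFP; elim: r => [_|i r IHr /= /andP[ir /IHr {}IHr]].
  rewrite big_nil; apply: (@is_derive_ext R_AbsRing R_NormedModule (fun=> 1)); last exact: is_derive_const.
  by move=> u; rewrite big_nil.
apply: (@is_derive_ext R_AbsRing R_NormedModule (fun u => F i u * \prod_(j <- r) F j u)).
  by move=> u; rewrite big_cons.
rewrite big_cons big_cons eqxx.
rewrite [X in _ * X](_ : _ = \prod_(j <- r) F j t); last first.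
  by apply: eq_big_seq => j jr; case: eqP ir => // <-; rewrite jr.
rewrite [X in _ + X](_ : _ = F i t * \sum_(k <- r)
    \prod_(j <- r) (if j == k then dF j else F j t)); last first.
  rewrite big_distrr; apply: eq_big_seq => k kr.
  by rewrite big_cons; case: eqP ir => // ->; rewrite kr.
by apply: is_derive_mult => // *; exact: Rmult_comm.
Qed.

(** Jacobi's formula: the product rule differentiates one row at a time, and the determinant with
    row [i] differentiated is expanded along that row. *)
Lemma is_derive_det n (M : R -> 'M[R]_n) (dM : 'M[R]_n) t :
  (forall i j, is_derive (fun u => M u i j) t (dM i j)) ->
  is_derive (fun u => \det (M u)) t (\sum_i \sum_j dM i j * cofactor (M t) i j).
Proof.
move=> dMP.
have D : is_derive (fun u => \det (M u)) t (\sum_(s : 'S_n) (-1) ^+ s *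
    \sum_i \prod_j (if j == i then dM j (s j) else M t j (s j))).
  apply: is_derive_bigsum => s; apply: is_derive_scal.
  by apply: is_derive_bigprod; first exact: index_enum_uniq.
suff -> : \sum_i \sum_j dM i j * cofactor (M t) i j = \sum_(s : 'S_n) (-1) ^+ s *
    \sum_i \prod_j (if j == i then dM j (s j) else M t j (s j)) by [].
under [RHS]eq_bigr do rewrite big_distrr.
rewrite [RHS]exchange_big; apply: eq_bigr => i _ /=.
pose A := \matrix_(j, k) (if j == i then dM j k else M t j k) : 'M[R]_n.
transitivity (\det A); last first.
  by apply: eq_bigr => s _; congr (_ * _); apply: eq_bigr => j _; rewrite mxE.
rewrite (expand_det_row _ i); apply: eq_bigr => j _; rewrite mxE eqxx.
congr (_ * (_ * \det _)); apply/matrixP => k l; rewrite !mxE.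
by rewrite eq_sym (negPf (neq_lift _ _)).
Qed.

(** * Gram matrices on [0, d] *)

Lemma is_RInt_bigsum (I : Type) (r : seq I) (F : I -> R -> R) (l : I -> R) a b :
  (forall i, is_RInt (F i) a b (l i)) ->
  is_RInt (fun t => \sum_(i <- r) F i t) a b (\sum_(i <- r) l i).
Proof.
move=> Fl; elim: r => [|i r IHr].
  rewrite big_nil; apply: (@is_RInt_ext R_NormedModule (fun=> 0)).
    by move=> u _; rewrite big_nil.
  rewrite -[X in is_RInt _ _ _ X](Rmult_0_r (b - a)); exact: is_RInt_const.
rewrite big_cons; apply: (@is_RInt_ext R_NormedModule (fun u => F i u + \sum_(j <- r) F j u)).
  by move=> u _; rewrite big_cons.
exact: is_RInt_plus.
Qed.

Lemma continuous_bigsum (I : Type) (r : seq I) (F : I -> R -> R) (t : R) :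
  (forall i, continuous (F i) t) -> continuous (fun u => \sum_(i <- r) F i u) t.
Proof.
move=> Fc; elim: r => [|i r IHr].
  by apply: (@continuous_ext R_UniformSpace R_UniformSpace (fun=> 0)); [move=> u; rewrite big_nil|exact: continuous_const].
apply: (@continuous_ext R_UniformSpace R_UniformSpace (fun u => F i u + \sum_(j <- r) F j u)).
  by move=> u; rewrite big_cons.
exact: continuous_plus.
Qed.

Section Gram.
Variables (n : nat) (phi : 'I_n -> R -> R).
Hypothesis phi_cont : forall i u, continuous (phi i) u.

Definition gram (d : R) : 'M[R]_n :=
  \matrix_(i, j) RInt (fun u => phi i u * phi j u) 0 d.

Definition lincomb (b : 'rV[R]_n) (u : R) : R := \sum_i b 0 i * phi i u.

Definition evalv (u : R) : 'rV[R]_n := \row_i phi i u.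

Lemma lincomb_continuous b u : continuous (lincomb b) u.
Proof.
apply: continuous_bigsum => i; apply: continuous_mult; last exact: phi_cont.
exact: continuous_const.
Qed.

Lemma gram_form (b c : 'rV[R]_n) d :
  (b *m gram d *m c^T) 0 0 = RInt (fun u => lincomb b u * lincomb c u) 0 d.
Proof.
symmetry; apply: is_RInt_unique.
apply: (@is_RInt_ext R_NormedModule
  (fun u => \sum_j \sum_i c 0 j * (b 0 i * (phi i u * phi j u)))).
  move=> u _; rewrite /lincomb big_distrr; apply: eq_bigr => j _ /=.
  rewrite big_distrl; apply: eq_bigr => i _ /=.
  by rewrite [RHS]mulrCA -[in RHS]mulrA.
rewrite mxE; apply: is_RInt_bigsum => j; rewrite !mxE big_distrl.
apply: is_RInt_bigsum => i /=; rewrite !mxE mulrC.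
apply: is_RInt_scal; apply: is_RInt_scal; apply: RInt_correct.
by apply: continuous_ex_RInt => u; apply: continuous_mult; apply: phi_cont.
Qed.

Lemma gram_form_ge0 (b : 'rV[R]_n) d : 0 <= d -> 0 <= (b *m gram d *m b^T) 0 0.
Proof.
move=> d0; rewrite gram_form; apply/RleP.
apply: RInt_ge_0; first exact/RleP.
  by apply: continuous_ex_RInt => u; apply: continuous_mult; apply: lincomb_continuous.
by move=> u _; apply: Rle_0_sqr.
Qed.

Lemma gram_tr d : (gram d)^T = gram d.
Proof.
by apply/matrixP => i j; rewrite !mxE; apply: RInt_ext => u _; rewrite mulrC.
Qed.

(** The entrywise derivative of the Gram matrix is the rank-one matrix of products
    [phi i d * phi j d], so Jacobi's sum becomes a quadratic form of the adjugate. *)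
Lemma is_derive_det_gram (d : R) : is_derive (fun u => \det (gram u)) d
  ((evalv d *m \adj (gram d) *m (evalv d)^T) 0 0).
Proof.
have -> : (evalv d *m \adj (gram d) *m (evalv d)^T) 0 0 =
    \sum_i \sum_j (\matrix_(i, j) (phi i d * phi j d)) i j * cofactor (gram d) i j.
  rewrite mxE; apply: eq_bigr => i _; rewrite !mxE big_distrl; apply: eq_bigr => j _ /=.
  by rewrite !mxE mulrC mulrA.
apply: is_derive_det => i j.
apply: (@is_derive_ext R_AbsRing R_NormedModule
   (fun u => RInt (fun v => phi i v * phi j v) 0 u)).
  by move=> u; rewrite mxE.
rewrite mxE; have cont u : continuous (fun v => phi i v * phi j v) u.
  by apply: continuous_mult; apply: phi_cont.
apply: (@is_derive_RInt R_NormedModule (fun v => phi i v * phi j v) _ 0).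
  by apply: filter_forall => u; apply: RInt_correct; apply: continuous_ex_RInt.
exact: cont.
Qed.

(** A vector killed by the Gram matrix gives a combination of zero norm. It vanishes at every [p k],
    so the vector is also killed by the evaluation matrix. *)
Lemma det_gram_neq0 (p : 'I_n -> R) : (forall k, Rlt 0 (p k) /\ Rlt (p k) 1) ->
  \det (\matrix_(i, k) phi i (p k)) != 0 -> \det (gram 1) != 0.
Proof.
move=> p01; apply: contraNN => /det0P[b b0 bG]; apply/det0P; exists b => //.
have zero := @RInt_sqr_eq0 (lincomb b) (fun u => @lincomb_continuous b u).
apply/rowP => k; rewrite !mxE.
transitivity (lincomb b (p k)); first by apply: eq_bigr => i _; rewrite mxE.
by apply: zero => //; rewrite -gram_form bG mul0mx mxE.
Qed.

Lemma evalv_mulmx (b : 'rV[R]_n) u : (evalv u *m b^T) 0 0 = lincomb b u.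
Proof. by rewrite mxE; apply: eq_bigr => i _; rewrite !mxE mulrC. Qed.

(* Up to the factor [\det (gram 1)], these are the coordinates of the
   reproducing kernel of the span of the [phi i] at the point 1. *)
Definition kernel1 : 'rV[R]_n := evalv 1 *m \adj (gram 1).

Lemma kernel1_gram (b : 'rV[R]_n) :
  (kernel1 *m gram 1 *m b^T) 0 0 = \det (gram 1) * lincomb b 1.
Proof.
by rewrite -mulmxA -[_ *m _ *m _]mulmxA (mulmxA (\adj _)) mul_adj_mx mul_scalar_mx
  -scalemxAr mxE evalv_mulmx.
Qed.

Lemma lincomb_kernel1 :
  (evalv 1 *m \adj (gram 1) *m (evalv 1)^T) 0 0 = lincomb kernel1 1.
Proof. by rewrite mxE; apply: eq_bigr => i _; rewrite !mxE. Qed.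

Lemma gram_cauchy_schwarz (b : 'rV[R]_n) (c : R) : 0 < c -> 0 < \det (gram 1) ->
  lincomb kernel1 1 <= c * \det (gram 1) ->
  lincomb b 1 ^+ 2 <= c * RInt (fun u => lincomb b u * lincomb b u) 0 1.
Proof.
move=> c0; set D := \det _; set e := lincomb _ 1 => D0 ecD.
rewrite -gram_form.
set w := kernel1.
have bw : (b *m gram 1 *m w^T) 0 0 = D * lincomb b 1.
  have -> : b *m gram 1 *m w^T = (w *m gram 1 *m b^T)^T.
    by rewrite !trmx_mul trmxK gram_tr mulmxA.
  by rewrite mxE kernel1_gram.
have ww : (w *m gram 1 *m w^T) 0 0 = D * e by rewrite kernel1_gram.
set beta := lincomb b 1 in bw *; set q := (b *m _ *m _) 0 0.
(* Up to a multiple, this vector subtracts from [b] a multiple of the kernel chosen so that, once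
   [e / D] is bounded by [c], the expansion reduces to [c * (c * q - beta ^+ 2)]. *)
have := gram_form_ge0 (c *: b - (beta / D) *: w) ler01.
rewrite [(_ - _)^T]linearB /= ![(_ *: _)^T]linearZ /= !mulmxBl !mulmxBr.
rewrite -!scalemxAl -!scalemxAr.
have wb : (w *m gram 1 *m b^T) 0 0 = D * beta by rewrite kernel1_gram.
move: bw wb ww; rewrite /q; move: (b *m _ *m b^T) (b *m _ *m w^T).
move: (w *m _ *m b^T) (w *m _ *m w^T) => wb ww bb bw bwE wbE wwE.
rewrite !mxE bwE wbE wwE => ge0.
have D1 : D != 0 by rewrite gt_eqF.
have {}ge0 : 0 <= c ^+ 2 * bb 0 0 - 2 * c * beta ^+ 2 + beta ^+ 2 * (e / D).
  apply: le_trans ge0 _; rewrite le_eqVlt; apply/orP; left; apply/eqP.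
  by field.
have eD : e / D <= c by rewrite ler_pdivrMr.
have := le_trans ge0 (lerD (lexx _) (ler_wpM2l (sqr_ge0 beta) eD)).
have -> : c ^+ 2 * bb 0 0 - 2 * c * beta ^+ 2 + beta ^+ 2 * c = c * (c * bb 0 0 - beta ^+ 2) by ring.
by rewrite pmulr_rge0 // subr_ge0.
Qed.
End Gram.

(** * Decreasing exponentials *)

Lemma addn_double_bin2 n : (n + 'C(n, 2).*2 = n * n)%N.
Proof.
by elim: n => // n IHn; rewrite binS bin1; lia.
Qed.

Lemma exp_exprn y m : exp y ^+ m = exp (m%:R * y).
Proof.
elim: m => [|m IHm]; first by rewrite expr0 !RealsE mul0r -R0E exp_0.
rewrite exprS IHm -[LHS]exp_plus; congr exp.
by rewrite -natr1 !RealsE; ring.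
Qed.

Section ExpGram.
Variables (n : nat) (lam : 'I_n -> R).
Hypothesis lam_ge0 : forall i, Rle 0 (lam i).

Definition decay (i : 'I_n) (u : R) : R := exp (- (lam i * u)).

Lemma decay_continuous i u : continuous (decay i) u.
Proof.
by apply: (@ex_derive_continuous R_AbsRing R_NormedModule); rewrite /decay; auto_derive.
Qed.

(** The Gram matrix of values at the nodes [k * d / (N + 1)], without the mesh width. Values of
    [decay] at these nodes are powers of the value at the first positive one, which brings in
    determinants of powers. *)
Definition sample (N : nat) (d : R) : 'M[R]_n :=
  \matrix_(i, j) \sum_(k < N.+1)
    decay i (d / INR N.+1) ^+ k * decay j (d / INR N.+1) ^+ k.

Lemma is_lim_sample (d : R) i j : Rlt 0 d ->
  is_lim_seq (fun N => ((d / INR N.+1) *: sample N d) i j) (gram decay d i j).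
Proof.
move=> d0; rewrite mxE.
have -> : RInt (fun u => decay i u * decay j u) 0 d =
          RInt (fun u => exp (- ((lam i + lam j) * u))) 0 d.
  apply: RInt_ext => u _; rewrite /decay -[LHS]exp_plus; congr exp.
  by rewrite !RealsE; ring.
set c := lam i + lam j.
have c0 : Rle 0 c by apply: Rplus_le_le_0_compat; apply: lam_ge0.
have E N : ((d / INR N.+1) *: sample N d) i j =
    d / INR N.+1 * \sum_(k < N.+1) (exp (- (c * d / INR N.+1))) ^+ k.
  rewrite !mxE; congr (_ * _); apply: eq_bigr => k _; rewrite -exprMn; congr (_ ^+ _).
  rewrite /decay -[LHS]exp_plus; congr exp.
  by rewrite /c !RealsE; ring.
apply: is_lim_seq_ext (fun N => esym (E N)) _.
case: c0 => [c0|c0].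
  rewrite RInt_exp_opp //.
  apply: is_lim_seq_ext (is_lim_seq_exp_ratio c0 d0) => N; congr (_ * _).
  set x := exp (- (c * d / INR N.+1)).
  have N0 : Rlt 0 (INR N.+1) by exact: lt_0_INR (PeanoNat.Nat.lt_0_succ N).
  have x1 : 1 - x != 0.
    rewrite subr_eq0 eq_sym lt_eqF //; apply/RltP; rewrite /x -R1E -exp_0.
    apply: exp_increasing; apply: Ropp_lt_gt_0_contravar.
    by apply: Rdiv_lt_0_compat => //; apply: Rmult_lt_0_compat.
  have -> : Rminus 1 (exp (- (c * d))) = 1 - x ^+ N.+1.
    congr (_ - _); rewrite exp_exprn; congr exp.
    by rewrite !RealsE; field; rewrite addrC natr1 pnatr_eq0.
  rewrite RdivE RminusE R1E -[X in X / _]opprB subrX1 -mulNr opprB.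
  by rewrite mulrC mulKf.
(* When the exponents sum to 0 the geometric ratio is 1, and every Riemann sum equals [d]
   exactly. *)
rewrite -c0; apply: (is_lim_seq_ext (fun=> d)) => [N|].
  rewrite (eq_bigr (fun=> 1)); last first.
    by move=> k _; rewrite !RealsE !mul0r oppr0 -R0E exp_0 R1E expr1n.
  rewrite sumr_const card_ord -INRE -mulrA mulVf ?mulr1 //.
  by apply/eqP; apply: not_0_INR.
rewrite (_ : RInt _ 0 d = d); first exact: is_lim_seq_const.
rewrite (RInt_ext (V := R_CompleteNormedModule) _ (fun=> IZR 1)); last first.
  by move=> u _; rewrite RplusE -/c -c0 !RealsE mul0r oppr0 -R0E exp_0.
by rewrite RInt_const /scal /= /mult /= Rminus_0_r Rmult_1_r.
Qed.

Lemma is_lim_det_sample (d : R) : Rlt 0 d ->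
  is_lim_seq (fun N => (d / INR N.+1) ^+ n * \det (sample N d)) (\det (gram decay d)).
Proof.
move=> d0; apply: is_lim_seq_ext (fun N => detZ _ _) _.
by apply: is_lim_seq_det => i j; apply: is_lim_sample.
Qed.

Lemma decay_bounds i u : Rle 0 u -> 0 <= decay i u <= 1.
Proof.
move=> u0; apply/andP; split; apply/RleP; first by left; apply: exp_pos.
have := exp_opp_le (Rmult_le_pos _ _ (lam_ge0 i) u0).
by rewrite Ropp_0 exp_0 /decay.
Qed.

Lemma det_gram_decay_ge0 : 0 <= \det (gram decay 1).
Proof.
have ge0 N : Rle 0 ((1 / INR N.+1) ^+ n * \det (sample N 1)); last first.
  by apply/RleP; apply: (is_lim_seq_le _ _ _ _ ge0 (is_lim_seq_const 0)
    (is_lim_det_sample Rlt_0_1)).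
apply/RleP; have N0 : 0 <= INR N.+1 :> R by apply/RleP; apply: pos_INR.
apply: mulr_ge0; first by rewrite exprn_ge0 // divr_ge0.
by rewrite /sample (power_gramE _ (decay^~ (1 / INR N.+1))) det_gram_ge0.
Qed.

Lemma det_gram_decay_scale (d : R) : Rlt 0 d -> Rle d 1 ->
  d ^+ (n * n) * \det (gram decay 1) <= \det (gram decay d).
Proof.
move=> d0 d1.
have le N : Rle (d ^+ (n * n) * ((1 / INR N.+1) ^+ n * \det (sample N 1)))
                ((d / INR N.+1) ^+ n * \det (sample N d)); last first.
  by apply/RleP; apply: (is_lim_seq_le _ _ _ _ le
    (is_lim_seq_scal_l _ (d ^+ (n * n)) _ (is_lim_det_sample Rlt_0_1))
    (is_lim_det_sample d0)).
apply/RleP.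
have N0 : Rlt 0 (INR N.+1) by exact: lt_0_INR (PeanoNat.Nat.lt_0_succ N).
have h0 : Rle 0 (1 / INR N.+1) by left; apply: Rdiv_lt_0_compat => //; apply: Rlt_0_1.
have dh0 : Rle 0 (d / INR N.+1) by left; apply: Rdiv_lt_0_compat.
have dh : d / INR N.+1 = d * (1 / INR N.+1) by rewrite mul1r.
have dle : 0 <= d by apply/RleP; left.
(* Of the exponent [n * n], the mesh width [d / (N + 1)] accounts for [n] and the comparison of
   sampled determinants for the remaining ['C(n, 2).*2]. *)
rewrite {1}dh !RmultE (exprMn n d) -addn_double_bin2 exprD mulrACA; apply: ler_wpM2l.
  by rewrite mulr_ge0 ?exprn_ge0 //; apply/RleP.
apply: det_gram_scale => // [i|i j].
  have /andP[-> _] := decay_bounds i h0; apply/RleP.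
  rewrite /decay !RdivE dh; apply: exp_opp_le; rewrite !RealsE; apply/RleP.
  rewrite ler_wpM2l //; first by apply/RleP; apply: lam_ge0.
  by apply: ler_piMl; [rewrite divr_ge0|apply/RleP].
rewrite -!RabsE; apply/RleP; rewrite /decay !RdivE dh.
have := @exp_diff_scale d (Rmult (lam i) (1 / INR N.+1)) (Rmult (lam j) (1 / INR N.+1)).
have E k : Rmult d (Rmult (lam k) (1 / INR N.+1)) = Rmult (lam k) (d * (1 / INR N.+1)).
  by rewrite !RealsE mulrCA.
rewrite !E !RdivE; apply; first (by split => //; left); exact: Rmult_le_pos.
Qed.

End ExpGram.

Lemma is_derive_exprn_scale m (c : R) :
  is_derive (fun u : R => u ^+ m * c) 1 (m%:R * c).
Proof.
apply: (@is_derive_ext R_AbsRing R_NormedModule (fun u => Rmult (pow u m) c)).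
  by move=> u; rewrite RpowE.
by auto_derive => //; rewrite !RealsE expr1n !mul1r mulr1.
Qed.

Lemma expsum_decay_bound n (lam : 'I_n -> R) (b : 'rV[R]_n) : (0 < n)%N ->
  (forall i, Rle 0 (lam i)) -> injective lam ->
  lincomb (decay lam) b 1 ^+ 2 <=
  (n * n)%:R * RInt (fun u => lincomb (decay lam) b u * lincomb (decay lam) b u) 0 1.
Proof.
move=> n0 lam0 lam_inj.
have D0 : 0 < \det (gram (decay lam) 1).
  rewrite lt_def det_gram_decay_ge0 // andbT.
  pose h := n.+1%:R^-1 : R.
  apply: (@det_gram_neq0 _ _ (@decay_continuous _ _) (fun k => k.+1%:R * h)).
    move=> k; split; apply/RltP; first by rewrite mulr_gt0 ?invr_gt0 ?ltr0n.
    by rewrite ltr_pdivrMr ?ltr0n // mul1r ltr_nat ltnS ltn_ord.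
  (* At the equally spaced nodes the rows are geometric progressions with ratios [z], distinct
     because [lam] is injective: a Vandermonde matrix up to a diagonal factor. *)
  pose z := \row_i decay lam i h : 'rV[R]_n.
  have -> : \matrix_(i, k) decay lam i (k.+1%:R * h) = diag_mx z *m (Vandermonde n z)^T.
    apply/matrixP => i k; rewrite mul_diag_mx !mxE -exprS /decay exp_exprn; congr exp.
    by rewrite !RealsE; ring.
  rewrite det_mulmx det_diag det_tr det_Vandermonde mulf_neq0 //.
    apply/prodf_neq0 => i _; rewrite mxE; apply/eqP.
    by apply: Rgt_not_eq; apply: exp_pos.
  apply/prodf_neq0 => i _; apply/prodf_neq0 => j ij; rewrite !mxE subr_eq0.
  apply: contraTneq ij => /exp_inv /Ropp_eq_compat; rewrite !Ropp_involutive.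
  move=> /Rmult_eq_reg_r e; rewrite (lam_inj j i) ?ltnn //; apply: e.
  by apply/eqP; rewrite /h invr_eq0 pnatr_eq0.
apply: gram_cauchy_schwarz => //; first exact: decay_continuous.
  by rewrite ltr0n muln_gt0 n0.
rewrite -lincomb_kernel1.
(* The two functions of [d] agree at 1 and are ordered on [(0, 1]]; comparing derivatives at 1
   yields the constant [n * n]. *)
apply/RleP; apply: (le_derive_of_touch (is_derive_det_gram (@decay_continuous _ _) 1)
  (is_derive_exprn_scale (n * n) (\det (gram (decay lam) 1)))).
  by rewrite expr1n mul1r.
by move=> d [d0 d1]; apply/RleP; apply: det_gram_decay_scale.
Qed.

(** * Monomials and the extremal polynomial *)

Section Monomials.
Variable n : nat.

Definition mono (i : 'I_n) (u : R) : R := u ^+ i.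

Lemma mono_continuous i u : continuous (mono i) u.
Proof.
apply: (@continuous_ext R_UniformSpace R_UniformSpace (fun v => pow v i)).
  by move=> v; rewrite RpowE.
by apply: (@ex_derive_continuous R_AbsRing R_NormedModule); auto_derive.
Qed.

Lemma gram_mono_entry d i j : gram mono d i j = d ^+ (i + j).+1 / (i + j).+1%:R.
Proof.
rewrite mxE -INRE -RpowE -RdivE -RInt_pow; apply: RInt_ext => u _.
by rewrite RpowE exprD.
Qed.

(** The entries are those at [d = 1] times [d ^+ i.+1 * d ^+ j], and the exponents [i.+1 + i] sum to
    [n * n]. *)
Lemma det_gram_mono_scale d :
  \det (gram mono d) = d ^+ (n * n) * \det (gram mono 1).
Proof.
have -> : gram mono d =
    diag_mx (\row_i d ^+ i.+1) *m gram mono 1 *m diag_mx (\row_i d ^+ i).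
  apply/matrixP => i j; rewrite mul_mx_diag mxE mul_diag_mx !mxE.
  have := gram_mono_entry d i j; have := gram_mono_entry 1 i j.
  rewrite !mxE => -> ->; rewrite expr1n mul1r -addSn exprD.
  by rewrite -!mulrA; congr (_ * _); rewrite mulrC.
rewrite !det_mulmx !det_diag mulrAC; congr (_ * _).
rewrite -big_split /= (eq_bigr (fun i : 'I_n => d ^+ (i.+1 + i))); last first.
  by move=> i _; rewrite !mxE exprD.
elim: n => [|m IHm]; first by rewrite big_ord0.
by rewrite big_ord_recr /= IHm -exprD; congr (_ ^+ _); lia.
Qed.

Lemma det_gram_mono_neq0 : \det (gram mono 1) != 0.
Proof.
pose p (k : 'I_n) := k.+1%:R / n.+1%:R : R.
apply: (@det_gram_neq0 _ _ mono_continuous p).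
  move=> k; split; apply/RltP; first by rewrite mulr_gt0 ?invr_gt0 ?ltr0n.
  by rewrite ltr_pdivrMr ?ltr0n // mul1r ltr_nat ltnS ltn_ord.
have -> : \matrix_(i, k) mono i (p k) = Vandermonde n (\row_k p k).
  by apply/matrixP => i k; rewrite !mxE.
rewrite det_Vandermonde; apply/prodf_neq0 => i _; apply/prodf_neq0 => j ij.
rewrite !mxE subr_eq0; apply: contraTneq ij => /mulIf e.
have /eqP := e (invr_neq0 (negbT (pnatr_eq0 _ n.+1))).
by rewrite eqr_nat eqSS => /eqP ->; rewrite ltnn.
Qed.

(** The kernel at 1 is extremal. Exact scaling makes its value at 1 equal to [n * n] times the
    determinant, while its squared norm is the determinant times that value. *)
Lemma extremal_poly : (0 < n)%N -> exists w : 'rV[R]_n, lincomb mono w 1 != 0 /\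
  lincomb mono w 1 ^+ 2 =
  (n * n)%:R * RInt (fun u => lincomb mono w u * lincomb mono w u) 0 1.
Proof.
move=> n0; exists (kernel1 mono).
have E : lincomb mono (kernel1 mono) 1 = (n * n)%:R * \det (gram mono 1).
  rewrite -lincomb_kernel1.
  have := is_derive_exprn_scale (n * n) (\det (gram mono 1)).
  move/(is_derive_ext _ _ _ _ (fun u => esym (det_gram_mono_scale u))).
  move/is_derive_unique <-; symmetry; apply: is_derive_unique.
  exact: is_derive_det_gram mono_continuous 1.
split; first by rewrite E mulf_neq0 ?det_gram_mono_neq0 // pnatr_eq0 -lt0n muln_gt0 n0.
rewrite -(gram_form mono_continuous) kernel1_gram.
by rewrite expr2 [X in X * _ = _]E mulrA.
Qed.

End Monomials.

(** * Transfer to exponential sums, and the sharp bound *)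

Lemma fsum_bigE n g : fsum n g = \sum_(i < n) g i.
Proof. by elim: n => [|n IHn]; rewrite ?big_ord0 // big_ord_recr /= IHn. Qed.

Lemma expsumE n a lam t : expsum n a lam t = \sum_(i < n) a i * exp (Rmult (lam i) t).
Proof. by rewrite /expsum fsum_bigE. Qed.

Lemma expsum_continuous n a lam t : continuous (expsum n a lam) t.
Proof.
apply: (@continuous_ext R_UniformSpace R_UniformSpace _ _ _ (fun u => esym (expsumE n a lam u))).
apply: continuous_bigsum => i; apply: continuous_mult; first exact: continuous_const.
by apply: (@ex_derive_continuous R_AbsRing R_NormedModule); auto_derive.
Qed.

Lemma admissible_homo n lam : admissible_exps n lam ->
  forall i j, (i < j)%N -> (j < n)%N -> lam i < lam j.
Proof.
move=> [_ inc] i; elim=> // j IHj; rewrite ltnS leq_eqVlt => /predU1P[<-|ij] jn.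
  by apply/RltP; apply: inc; apply/ssrnat.ltP.
by apply: lt_trans (IHj ij (ltnW jn)) _; apply/RltP; apply: inc; apply/ssrnat.ltP.
Qed.

Lemma expsum_bound n a lam : (0 < n)%N -> admissible_exps n lam ->
  expsum n a lam 0 ^+ 2 <=
  (n * n)%:R * RInt (fun t => expsum n a lam t * expsum n a lam t) 0 1.
Proof.
move=> n0 adm.
pose l (i : 'I_n) := lam i.
have l0 i : Rle 0 (l i).
  case: adm (admissible_homo adm) => lam0 _ homo; rewrite /l.
  case: i => -[|i] ilt //=; apply: (Rle_trans _ _ _ lam0); left.
  by apply/RltP; apply: homo.
have linj : injective l.
  move=> i j; rewrite /l => e; apply: val_inj.
  by case: (ltngtP i j) => // [/(admissible_homo adm)|/(admissible_homo adm)] /(_ (ltn_ord _));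
    rewrite e ltxx.
(* The reflection [t = 1 - u] moves a factor [exp (l i)] into each coefficient. *)
pose b := \row_i (a i * exp (l i)) : 'rV[R]_n.
have E u : lincomb (decay l) b u = expsum n a lam (Rminus 1 u).
  rewrite expsumE; apply: eq_bigr => i _; rewrite mxE -mulrA; congr (_ * _).
  by rewrite /decay -[LHS]exp_plus; congr exp; rewrite !RealsE /l; ring.
have := expsum_decay_bound b n0 l0 linj; rewrite E Rminus_diag => /le_trans; apply.
apply: ler_wpM2l; first exact: ler0n.
rewrite -(RInt_flip (f := fun t => expsum n a lam t * expsum n a lam t)); last first.
  by move=> u; apply: continuous_mult; apply: expsum_continuous.
by rewrite le_eqVlt; apply/orP; left; apply/eqP; apply: RInt_ext => u _; rewrite E.
Qed.

(** The substituted argument is affine in [exp (h * t)], so the composition [p] is a polynomial of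
    degree below [n] in it; its coefficients are the required [a]. *)
Lemma expsum_of_poly n (w : 'rV[R]_n) h : Rlt 0 h -> exists a, forall t,
  expsum n a (fun j => Rmult (INR j) h) t =
  lincomb (@mono n) w (Rdiv (Rminus (exp h) (exp (Rmult h t))) (Rminus (exp h) 1)).
Proof.
move=> h0.
pose q : {poly R} := (Rminus (exp h) 1)^-1 *: ((exp h)%:P - 'X).
pose p : {poly R} := \sum_(i < n) w 0 i *: q ^+ i.
have sq : (size q <= 2)%N.
  by rewrite (leq_trans (size_scale_leq _ _)) // -opprB size_polyN size_XsubC.
have sp : (size p <= n)%N.
  apply: leq_trans (size_sum _ _ _) _; apply/bigmax_leqP => i _; rewrite (leq_trans (size_scale_leq _ _)) //.
  rewrite (leq_trans (size_poly_exp_leq _ _)) //.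
  by apply: leq_trans (ltn_ord i); rewrite ltnS; move: sq; case: (size q) => [|[|[|]]] //; lia.
exists (fun j => p`_j) => t; rewrite expsumE.
transitivity p.[exp (Rmult h t)].
  rewrite (horner_coef_wide _ sp); apply: eq_bigr => i _; congr (_ * _).
  by rewrite exp_exprn; congr exp; rewrite !RealsE; ring.
rewrite horner_sum; apply: eq_bigr => i _; rewrite hornerZ horner_exp; congr (_ * _ ^+ _).
by rewrite hornerZ hornerD hornerN hornerC hornerX mulrC.
Qed.

Lemma expsum_sqr_continuous n a lam t : continuous (fun t => pow (expsum n a lam t) 2) t.
Proof.
apply: (@continuous_ext R_UniformSpace R_UniformSpace
  (fun t => Rmult (expsum n a lam t) (expsum n a lam t))).
  by move=> u; rewrite /= Rmult_1_r.
by apply: continuous_mult; apply: expsum_continuous.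
Qed.

Lemma RInt_expsum_sqr n a lam (pr : Riemann_integrable (fun t => pow (expsum n a lam t) 2) 0 1) :
  RiemannInt pr = RInt (fun t => Rmult (expsum n a lam t) (expsum n a lam t)) 0 1.
Proof.
by rewrite -RInt_Reals; apply: RInt_ext => u _; rewrite /= Rmult_1_r.
Qed.

Local Close Scope ring_scope.

Theorem theorem4p1 (n : nat) (hn : (1 <= n)%coq_nat) :
  (forall (a lam : nat -> R), admissible_exps n lam ->
     forall pr : Riemann_integrable (fun t => (expsum n a lam t) ^ 2) 0 1,
       Rabs (expsum n a lam 0) <= INR n * sqrt (RiemannInt pr))
  /\
  (forall eps : R, 0 < eps ->
     exists (a lam : nat -> R), admissible_exps n lam /\
       (exists t : R, expsum n a lam t <> 0) /\
       exists pr : Riemann_integrable (fun t => (expsum n a lam t) ^ 2) 0 1,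
         Rabs (expsum n a lam 0) > (INR n - eps) * sqrt (RiemannInt pr)).
Proof.
have n0 : ssrnat.leq 1 n by apply/ssrnat.leP.
have nR : 0 < INR n by apply: lt_0_INR.
have sqr_ge0 f : (forall u, continuous f u) -> 0 <= RInt (fun t => f t * f t) 0 1.
  move=> fc; apply: RInt_ge_0; [lra| |by move=> u _; apply: Rle_0_sqr].
  by apply: continuous_ex_RInt => u; apply: continuous_mult.
split=> [a lam adm pr|eps e0].
  apply: le_of_sqr_le; [exact: pos_INR| |].
    by rewrite RInt_expsum_sqr; apply: sqr_ge0; apply: expsum_continuous.
  rewrite RInt_expsum_sqr -mult_INR INRE; apply/RleP.
  exact: expsum_bound.
have [w [w1 w2]] := extremal_poly n0.
(* This step [h] makes the loss [exp h] in the squared norm exactly the factor [exp (eps / n)]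
   tolerated by [lt_of_almost_sqr]. *)
have h0 : 0 < eps / INR n by apply: Rdiv_lt_0_compat.
have [a aE] := expsum_of_poly w h0.
set lam := (fun j => INR j * (eps / INR n)) in aE.
have f0 : expsum n a lam 0 = lincomb (@mono n) w 1.
  rewrite aE Rmult_0_r exp_0; congr lincomb; apply: Rdiv_diag.
  have := exp_ineq1 (eps / INR n) (Rgt_not_eq _ _ h0); lra.
have f1 : expsum n a lam 0 <> 0 by rewrite f0; apply/eqP.
exists a, lam; split.
  split; first by rewrite /lam Rmult_0_l; apply: Rle_refl.
  by move=> j _; rewrite /lam S_INR; nra.
split; first by exists 0.
exists (ex_RInt_Reals_0 _ _ _ (continuous_ex_RInt _ _ (@expsum_sqr_continuous n a lam))).
apply: lt_of_almost_sqr => //.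
  by rewrite RInt_expsum_sqr; apply: sqr_ge0; apply: expsum_continuous.
rewrite RInt_expsum_sqr.
pose P u := lincomb (@mono n) w u * lincomb (@mono n) w u.
have Pc u : continuous P u.
  by apply: continuous_mult; apply: lincomb_continuous; apply: mono_continuous.
have := RInt_exp_subst_le h0 Pc (fun u => Rle_0_sqr _).
rewrite (RInt_ext _ (fun t => expsum n a lam t * expsum n a lam t)); last first.
  by move=> u _; rewrite aE.
have -> : expsum n a lam 0 * expsum n a lam 0 = INR n * INR n * RInt P 0 1.
  by rewrite f0 -mult_INR INRE; exact: w2.
have := Rmult_lt_0_compat _ _ nR nR; nra.
Qed.
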